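(* Let $\lambda,\mu$ be partitions with lengths $r_1,r_2$ and associated sequences $(n_i)_{i=1}^{r_1}$, $(m_j)_{j=1}^{r_2}$, and set $r=r_1+r_2$. Let $\alpha,\beta\in\mathbb{R}$, let $n\in\mathbb{N}_{\lambda,\mu}$, and put $s=n-|\lambda|-|\mu|+r_1$. Assume that $$\alpha+\beta+n_i\notin\{-1,-2,\dots,-n_i\}\ (1\le i\le r_1),\qquad \alpha+\beta+s\notin\{-1,-2,\dots,-s-2r\},$$ $$\alpha-\beta+m_j\notin\{-1,-2,\dots,-m_j\}\ (1\le j\le r_2),$$ $$\beta\neq m_j-n_i\ (1\le i\le r_1,\ 1\le j\le r_2),\qquad \beta\neq m_j-s\ (1\le j\le r_2).$$ If $\alpha+r>-1$ and $\beta+r>-1$, then the number $N(n)$ of zeros, counted with multiplicity, of $P^{(\alpha,\beta)}_{\lambda,\mu,n}$ in $(-1,1)$ satisfies $$n-2(|\lambda|+|\mu|+r_2)\le N(n).$$ Moreover (with $\lambda,\mu,\alpha,\beta$ fixed), the number of simple zeros of $P^{(\alpha,\beta)}_{\lambda,\mu,n}$ in $(-1,1)$ grows to infinity as $n\to\infty$, $n\in\mathbb{N}_{\lambda,\mu}$.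
   Context: Jacobi polynomials: for $\alpha,\beta\in\mathbb{R}$ and an integer $n\ge 0$, $P_n^{(\alpha,\beta)}(x)=2^{-n}\sum_{j=0}^n\binom{n+\alpha}{j}\binom{n+\beta}{n-j}(x-1)^{n-j}(x+1)^j$ (generalized binomial coefficients). A set $\{-1,-2,\dots,-k\}$ is empty when $k=0$. Wronskian: $\mathrm{Wr}[g_1,\dots,g_k]=\det\big(\tfrac{d^{i-1}}{dx^{i-1}}g_j\big)_{1\le i,j\le k}$. Partitions: a partition $\lambda$ is a weakly decreasing finite (possibly empty) sequence of positive integers $\lambda_1\ge\dots\ge\lambda_{r_1}$; $r_1$ is its length, $|\lambda|=\sum_i\lambda_i$, and its associated strictly decreasing sequence is $n_i=\lambda_i+r_1-i$, $1\le i\le r_1$. Likewise $\mu$ has length $r_2$ and associated sequence $m_j=\mu_j+r_2-j$, $1\le j\le r_2$. Degree sequence: $\mathbb{N}_{\lambda,\mu}=\{n\in\mathbb{Z}_{\ge0}: n\ge|\lambda|+|\mu|-r_1\text{ and }n-|\lambda|-|\mu|\ne\lambda_j-j\text{ for }j=1,\dots,r_1\}$. Exceptional Jacobi polynomials: put $f_j(x)=P^{(\alpha,\beta)}_{n_j}(x)$ for $1\le j\le r_1$ and $f_{r_1+j}(x)=(1+x)^{-\beta}P^{(\alpha,-\beta)}_{m_j}(x)$ for $1\le j\le r_2$. For $n\in\mathbb{N}_{\lambda,\mu}$ and $s=n-|\lambda|-|\mu|+r_1$, $$P^{(\alpha,\beta)}_{\lambda,\mu,n}(x)=(1+x)^{(\beta+r_1+1)r_2}\,\mathrm{Wr}[f_1,\dots,f_r,P_s^{(\alpha,\beta)}],$$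 which is a polynomial in $x$ (computed on $x>-1$ and extended to $\mathbb{C}$). *)

(* Defs.v *)
From HB Require Import structures.
From mathcomp Require Import all_boot all_order all_algebra.
From mathcomp Require Import polyrcf.
From mathcomp Require Import all_classical all_reals all_analysis.

Set Implicit Arguments.
Unset Strict Implicit.
Unset Printing Implicit Defensive.

Import Order.TTheory GRing.Theory Num.Theory.
Import numFieldNormedType.Exports.

Local Open Scope ring_scope.

Definition is_partition (la : seq nat) : bool :=
  sorted geq la && all (fun k => 0 < k)%N la.

(* Indices are 0-based, so this is n_(i+1) = la_(i+1) + r - (i+1); for
   i < size la the subtraction is not truncated. *)
Definition assoc (la : seq nat) (i : nat) : nat :=
  (nth 0 la i + (size la - i.+1))%N.

(* The integer inequations are la_j - j with j = i + 1. *)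
Definition in_degree_seq (la mu : seq nat) (n : nat) : bool :=
  ((sumn la)%:Z + (sumn mu)%:Z - (size la)%:Z <= n%:Z) &&
  [forall i : 'I_(size la),
     n%:Z - (sumn la)%:Z - (sumn mu)%:Z != (nth 0%N la i)%:Z - i.+1%:Z].

(* s = n - |la| - |mu| + r1, which is a natural number for every n of the
   degree sequence. *)
Definition shifted_degree (la mu : seq nat) (n : nat) : nat :=
  (n + size la - (sumn la + sumn mu))%N.

Section Jacobi.
Variable R : realType.
Implicit Types (alpha beta a x : R) (la mu : seq nat).

Definition gbinom a (k : nat) : R := (\prod_(i < k) (a - i%:R)) / k`!%:R.

Definition jacobi alpha beta (n : nat) : {poly R} :=
  2^-1 ^+ n *: \sum_(j < n.+1)
    (gbinom (n%:R + alpha) j * gbinom (n%:R + beta) (n - j)) *: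
      (('X - 1) ^+ (n - j) * ('X + 1) ^+ j).

(* [:: -1; -2; ...; -k] *)
Definition negatives (k : nat) : seq R := [seq - j%:R | j <- iota 1 k].

Definition wronskian (gs : seq (R -> R)) x : R :=
  \det (\matrix_(i < size gs, j < size gs)
          derive1n i (nth (fun=> 0) gs j) x).

Definition seed_functions alpha beta la mu : seq (R -> R) :=
  [seq (fun x => (jacobi alpha beta (assoc la i)).[x]) | i <- iota 0 (size la)]
  ++
  [seq (fun x => (1 + x) `^ (- beta) *
                 (jacobi alpha (- beta) (assoc mu j)).[x])
     | j <- iota 0 (size mu)].

Definition exceptional_jacobi_fun alpha beta la mu (n : nat) x : R :=
  (1 + x) `^ ((beta + (size la)%:R + 1) * (size mu)%:R) *
  wronskian
    (rcons (seed_functions alpha beta la mu)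
           (fun y => (jacobi alpha beta (shifted_degree la mu n)).[y])) x.

(* The polynomial extending the function above from ]-1, +oo[ (x > -1 is
   needed for the real powers); it exists for all parameters and is unique,
   since a polynomial is determined by its values on ]-1, +oo[. The default
   value 0 of xget is never reached. *)
Definition exceptional_jacobi alpha beta la mu (n : nat) : {poly R} :=
  xget 0 [set p : {poly R} | forall x, -1 < x ->
    p.[x] = exceptional_jacobi_fun alpha beta la mu n x]%classic.

(* roots p (-1) 1 lists each root of p != 0 in ]-1, 1[ exactly once. *)
Definition nb_zeros (p : {poly R}) : nat :=
  (\sum_(x <- roots p (-1) 1) mup x p)%N.

Definition nb_simple_zeros (p : {poly R}) : nat :=
  count (fun x => mup x p == 1%N) (roots p (-1) 1).

End Jacobi.

(* Main.v *)
Require Import Defs.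
From mathcomp Require Import all_boot all_order all_algebra all_fingroup.
From mathcomp Require Import polyrcf ring lra zify.
From mathcomp Require Import all_classical all_reals all_analysis.

Set Implicit Arguments.
Unset Strict Implicit.
Unset Printing Implicit Defensive.

Import Order.TTheory GRing.Theory Num.Theory.
Import numFieldNormedType.Exports.

Local Open Scope classical_set_scope.
Local Open Scope ring_scope.

(* In the variable t = 1 + x every entry of the Wronskian is a power of t times
   a polynomial; expanding the determinant over monomials, the terms in which
   two functions of the same kind contribute the same power vanish, and the
   leading one is a Vandermonde determinant. Hence, with
   C = |la| + |mu| - r1, the exceptional polynomial is
     P = sum_(j <= r) Q_j D^j P_s,   deg Q_j <= C + j,   P <> 0,
   and deg P <= n = s + C. As D^j P_s is proportional to
   P_(s-j)^(alpha+j, beta+j), Rodrigues' formula and integration by parts show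
   that P is orthogonal, for the weight (1-x)^(alpha+r) (1+x)^(beta+r), to all
   polynomials of degree < K = s - C - 2r = n - 2 (|la| + |mu| + r2). So P
   changes sign at least K times in ]-1, 1[; and since deg P - K stays bounded,
   all but a bounded number of these sign changes are simple zeros.

   Integrals are avoided: orthogonality to v is expressed by saying that v P
   times the weight w is the derivative of (1 - x^2) w H for some polynomial H.
   This function vanishes at both ends, so v P cannot have constant sign. *)

(** * Jacobi polynomials: Rodrigues' formula, derivatives, degree, orthogonality *)

Section JacobiOperator.
Variable R : realType.
Implicit Types (a b : R) (p q v H Y : {poly R}).

(* With w = (1 - x)^a (1 + x)^b, [w * jraise a b H] is the derivative of
   [(1 - x^2) * w * H]. *)
Definition jraise a b H : {poly R} :=
  (1 - 'X^2) * H^`() + ((b + 1) *: (1 - 'X) - (a + 1) *: (1 + 'X)) * H.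

Lemma jraiseD a b p q : jraise a b (p + q) = jraise a b p + jraise a b q.
Proof. by rewrite /jraise derivD -!mul_polyC; ring. Qed.

Lemma jraiseZ a b (c : R) p : jraise a b (c *: p) = c *: jraise a b p.
Proof. by rewrite /jraise derivZ -!mul_polyC; ring. Qed.

Lemma jraise0 a b : jraise a b 0 = 0.
Proof. by rewrite /jraise deriv0 !mulr0 addr0. Qed.

(** Commutation relation behind [jacobi_deriv]: the derivative of a Rodrigues step is again a
    Rodrigues step, with both parameters shifted, up to a multiple of [H]. *)
Lemma deriv_jraise a b H :
  (jraise a b H)^`() = jraise (a + 1) (b + 1) H^`() - (a + b + 2) *: H.
Proof.
rewrite /jraise -!mul_polyC !poly.derivE/= !polyCD; ring.
Qed.

(** Leibniz rule corrected for the weight: the extra factor (1 - x^2)^m has logarithmic derivative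
    -2 m x / (1 - x^2). *)
Lemma jraise_shift a b (m : nat) v Y :
  jraise (a + m%:R) (b + m%:R) (v * Y) =
    v * jraise a b Y + ((1 - 'X^2) * v^`() - (m%:R *+ 2) *: ('X * v)) * Y.
Proof.
rewrite /jraise -!mul_polyC !poly.derivE/= !polyCD polyCMn; ring.
Qed.

Lemma gbinomS a k : gbinom a k.+1 * k.+1%:R = gbinom a k * (a - k%:R).
Proof.
rewrite /gbinom big_ord_recr/= factS natrM.
by field; rewrite nat1r !pnatr_eq0 -lt0n fact_gt0.
Qed.

Lemma jraise_monomial a b (i j : nat) :
  jraise a b (('X - 1) ^+ i * ('X + 1) ^+ j) =
  - ((i%:R + a + 1) *: (('X - 1) ^+ i * ('X + 1) ^+ j.+1)
    + (j%:R + b + 1) *: (('X - 1) ^+ i.+1 * ('X + 1) ^+ j)).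
Proof.
rewrite /jraise -!mul_polyC !poly.derivE/= !polyCD !polyC_natr.
rewrite !deriv_exp !poly.derivE /= !addr0 ?subr0.
rewrite -(mulr_natr _ i) -(mulr_natr _ j).
case: i j => [|i] [|j]; rewrite /= ?mulr0 ?expr0 ?exprS; ring.
Qed.

Lemma jacobi0 a b : jacobi a b 0 = 1.
Proof.
rewrite /jacobi big_ord1 subn0 !expr0 mulr1 scale1r.
by rewrite /gbinom !big_ord0 fact0 invr1 !mulr1 scale1r.
Qed.

Lemma jraise_sum a b n (F : 'I_n -> {poly R}) :
  jraise a b (\sum_(i < n) F i) = \sum_(i < n) jraise a b (F i).
Proof.
exact: (big_morph _ (jraiseD a b) (jraise0 a b)).
Qed.

Lemma jacobi_raise a b k :
  jraise a b (jacobi (a + 1) (b + 1) k) = - (2 * k.+1%:R) *: jacobi a b k.+1.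
Proof.
rewrite /jacobi jraiseZ jraise_sum exprS scalerA mulNr.
set A := gbinom (k.+1%:R + a); set B := gbinom (k.+1%:R + b).
have eA : k%:R + (a + 1) = k.+1%:R + a by rewrite -natr1; ring.
have eB : k%:R + (b + 1) = k.+1%:R + b by rewrite -natr1; ring.
rewrite eA eB -/A -/B.
transitivity (- 2^-1 ^+ k *: \sum_(j < k.+1)
    (((k.+1 - j)%:R + a) * (A j * B (k - j)%N) *: 
        (('X - 1) ^+ (k - j) * ('X + 1) ^+ j.+1)
     + (j.+1%:R + b) * (A j * B (k - j)%N) *: 
        (('X - 1) ^+ (k.+1 - j) * ('X + 1) ^+ j)) : {poly R}).
  rewrite scaleNr -scalerN -sumrN; congr (_ *: _); apply: eq_bigr => j _.
  rewrite jraiseZ jraise_monomial.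
  rewrite subSn ?leq_ord// -[(k - j).+1%:R]natr1 -[j.+1%:R]natr1.
  rewrite -!mul_polyC !polyCM !polyCD; ring.
have -> : 2 * k.+1%:R * (2^-1 * 2^-1 ^+ k) = k.+1%:R * 2^-1 ^+ k :> R.
  by rewrite mulrACA divff ?pnatr_eq0// mul1r.
rewrite !scaleNr [k.+1%:R * _]mulrC -scalerA.
congr (- (_ *: _)); rewrite scaler_sumr big_split/=.
(* The factor k + 1 is split as j + (k + 1 - j). The first part vanishes at j = 0 and the second at
   j = k + 1, so each matches one of the two sums on the left through [gbinomS]. *)
rewrite (eq_bigr (fun j : 'I_k.+2 =>
    (j%:R * (A j * B (k.+1 - j)%N)) *: (('X - 1) ^+ (k.+1 - j) * ('X + 1) ^+ j)
    + ((k.+1 - j)%:R * (A j * B (k.+1 - j)%N)) *: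
        (('X - 1) ^+ (k.+1 - j) * ('X + 1) ^+ j))); last first.
  by move=> j _; rewrite scalerA -scalerDl -mulrDl -natrD subnKC// -ltnS.
rewrite big_split/= [X in _ = X + _]big_ord_recl mul0r scale0r add0r; congr (_ + _).
  apply: eq_bigr => j _; rewrite !lift0 subSS; congr (_ *: _).
  rewrite [RHS]mulrA [X in _ = X * _]mulrC /A gbinomS natrB; last exact: ltnW.
  by rewrite -/A; ring.
rewrite [RHS]big_ord_recr/= subnn mul0r scale0r addr0.
apply: eq_bigr => j _; congr (_ *: _).
have jk : (j <= k)%N by rewrite -ltnS.
rewrite subSn// [RHS]mulrCA [X in _ = _ * X]mulrC /B gbinomS natrB// -/B.
by rewrite -natr1 -[k.+1%:R]natr1; ring.
Qed.

Lemma jacobiS a b k :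
  jacobi a b k.+1 =
    - (2 * k.+1%:R)^-1 *: jraise a b (jacobi (a + 1) (b + 1) k).
Proof.
by rewrite jacobi_raise scalerA mulrNN mulVf ?scale1r//.
Qed.

(** By induction through [jacobiS]: after [deriv_jraise] and [jacobi_raise] both terms are multiples
    of the same Jacobi polynomial. For k = 0 the constant is 0, so the truncated [k.-1] is
    harmless. *)
Lemma jacobi_deriv a b k :
  exists c, (jacobi a b k)^`() = c *: jacobi (a + 1) (b + 1) k.-1.
Proof.
elim: k a b => [|k IH] a b.
  by exists 0; rewrite jacobi0 derivC scale0r.
case: k IH => [|k] IH.
  exists (2^-1 * (a + b + 2)).
  rewrite jacobiS derivZ deriv_jraise !jacobi0 derivC jraise0 sub0r scalerN.
  by rewrite scaleNr opprK scalerA mulr1.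
have [c dc] := IH (a + 1) (b + 1).
exists (- (2 * k.+2%:R)^-1 * (c * - (2 * k.+1%:R) - (a + b + 2))).
rewrite jacobiS derivZ deriv_jraise dc jraiseZ jacobi_raise.
by rewrite scalerA -scalerBl scalerA.
Qed.

Lemma jacobi_derivn a b k j :
  (j <= k)%N ->
  exists c, (jacobi a b k)^`(j) = c *: jacobi (a + j%:R) (b + j%:R) (k - j).
Proof.
elim: j => [_|j IH jk]; first by exists 1; rewrite scale1r subn0 !addr0.
have [c dc] := IH (ltnW jk).
have [c' dc'] := jacobi_deriv (a + j%:R) (b + j%:R) (k - j).
exists (c * c'); rewrite derivnS dc derivZ dc' scalerA -!natr1 !addrA.
by rewrite subnS.
Qed.

Lemma coef_jraise a b (d : nat) p : (size p <= d.+1)%N ->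
  (jraise a b p)`_d.+1 = - (d%:R + a + b + 2) * p`_d.
Proof.
move=> sp.
have -> : jraise a b p = p^`() - p^`() * 'X^2 + (b - a) *: p
     - (a + b + 2) *: (p * 'X).
  by rewrite /jraise -!mul_polyC !polyCD !polyCN; ring.
have sp1 : p`_d.+1 = 0 by rewrite nth_default.
have sp2 : p`_d.+2 = 0 by rewrite nth_default// ltnW.
rewrite !(coefD, coefN, coefZ) coefMX coefMXn !coef_deriv/= sp1 sp2.
case: d {sp sp1 sp2} => [|d] /=; first by ring.
rewrite subn2/= -mulr_natr -natr1; ring.
Qed.

Lemma size_jraise a b (d : nat) p :
  (size p <= d)%N -> (size (jraise a b p) <= d.+1)%N.
Proof.
move=> sp; apply/leq_sizeP => i di; case: i di => // i di.
rewrite coef_jraise; last exact: leq_trans sp (ltnW _).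
by rewrite nth_default ?mulr0// (leq_trans sp).
Qed.

Lemma size_jacobi_leq a b k : (size (jacobi a b k) <= k.+1)%N.
Proof.
elim: k a b => [|k IH] a b; first by rewrite jacobi0 size_poly1.
by rewrite jacobiS (leq_trans (size_scale_leq _ _))// size_jraise.
Qed.

(** Each Rodrigues step multiplies the leading coefficient by a nonzero multiple of one factor a + b
    + k + i, for i = 1, ..., k. In this form the condition is stable under the induction, which
    lowers k and i by one and raises a and b by one. *)
Lemma coef_jacobi_neq0 a b k :
  a + b + k%:R \notin negatives R k -> (jacobi a b k)`_k != 0.
Proof.
move=> hk.
have : forall i : nat, (0 < i <= k)%N -> a + b + k%:R + i%:R != 0.
  move=> i /andP[i0 ik]; apply: contraNneq hk => /eqP; rewrite addr_eq0 => /eqP ->.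
  by apply/mapP; exists i; rewrite // mem_iota i0 add1n.
elim: k a b {hk} => [|k IH] a b hk; first by rewrite jacobi0 coef1 oner_eq0.
rewrite jacobiS coefZ coef_jraise ?size_jacobi_leq// mulf_neq0//.
rewrite mulf_neq0//.
  have := hk 1%N isT; rewrite oppr_eq0.
  by congr (_ != _); rewrite -natr1; ring.
apply: IH => i /andP[i0 ik].
have := hk i.+1 ik.
by congr (_ != _); rewrite -natr1 -[i.+1%:R]natr1; ring.
Qed.

Lemma size_jacobi a b k :
  a + b + k%:R \notin negatives R k -> size (jacobi a b k) = k.+1.
Proof.
move=> /coef_jacobi_neq0 h; apply/eqP; rewrite eqn_leq size_jacobi_leq/=.
by rewrite ltnNge; apply: contra h => /leq_sizeP ->.
Qed.

(* Rodrigues' formula (jacobiS) followed by k integrations by parts; each of the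
   first m of them lowers by one the excess m of the weight. *)
Lemma jacobi_orthogonal a b (m k : nat) v : (size v + 2 * m <= k)%N ->
  exists H, v * jacobi a b k = jraise (a + m%:R) (b + m%:R) H.
Proof.
elim: k a b m v => [|k IH] a b m v.
  rewrite leqn0 addn_eq0 => /andP[]; rewrite size_poly_eq0 => /eqP ->.
  by exists 0; rewrite mul0r jraise0.
(* [w] is chosen so that (v (1 - x^2)^m)' = (1 - x^2)^(m-1) w. *)
move=> svm; pose w := (1 - 'X^2) * v^`() - (m%:R *+ 2) *: ('X * v).
have sdv : (size v^`() <= (size v).-1)%N by rewrite size_poly.
have [H vH] : exists H,
    w * jacobi (a + 1) (b + 1) k = jraise (a + m%:R) (b + m%:R) H.
  case: m svm @w => [|m] svm /=; rewrite ?mul0rn ?scale0r ?subr0.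
    have [H vH] : exists H, v^`() * jacobi (a + 1) (b + 1) k =
        jraise (a + 1 + 0%:R) (b + 1 + 0%:R) H.
      by apply: IH; lia.
    (* For m = 0 the factor 1 - x^2 of [w] passes from the weight with parameters a + 1, b + 1 to
       the argument of [jraise a b]. *)
    exists ((1 - 'X^2) * H).
    rewrite !addr0 in vH *; rewrite -mulrA vH /jraise.
    rewrite -!mul_polyC !poly.derivE/= !polyCD; ring.
  set w := _ - _.
  have sw : (size w + 2 * m <= k)%N.
    have [v0|v0] := eqVneq v 0.
      by rewrite /w v0 deriv0 !mulr0 scaler0 subr0 size_poly0; lia.
    have vp : (0 < size v)%N by rewrite lt0n size_poly_eq0.
    suff : (size w <= (size v).+1)%N by lia.
    rewrite (leq_trans (size_polyD _ _))// size_polyN geq_max; apply/andP; split.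
      apply: leq_trans (size_polyMleq _ _) _.
      apply: (@leq_trans (3 + (size v).-1).-1); last by lia.
      rewrite -subn1 -[X in (_ <= X)%N]subn1 leq_sub2r// leq_add//.
      by rewrite (leq_trans (size_polyD _ _))// size_polyN size_polyXn size_poly1.
    by rewrite (leq_trans (size_scale_leq _ _))// mulrC size_mulX.
  have [H vH] := IH (a + 1) (b + 1) m _ sw.
  exists H.
  by rewrite vH -!addrA nat1r.
move: vH; rewrite jacobiS; move: (jacobi _ _ k) => J vH.
(* The first term is the boundary term of the integration by parts, the second comes from the
   remaining integral of [w * J]. *)
exists (- (2 * k.+1%:R)^-1 *: (v * J) + (2 * k.+1%:R)^-1 *: H).
rewrite jraiseD !jraiseZ -vH jraise_shift /w -!mul_polyC polyCN; ring.
Qed.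

End JacobiOperator.

(** * The primitive of the weighted polynomial and its sign *)

Section Sign.
Variable R : realType.
Implicit Types (a b : R) (p q v H Y : {poly R}).

Lemma horner_infinite_eq p q : (forall n : nat, p.[n%:R] = q.[n%:R]) -> p = q.
Proof.
move=> pq; apply/eqP; rewrite -subr_eq0; apply/eqP.
apply: (@roots_geq_poly_eq0 _ _ [seq n%:R | n <- iota 0 (size (p - q))]).
- by apply/allP => _ /mapP[n _ ->]; rewrite rootE hornerD hornerN pq subrr.
- by rewrite map_inj_uniq ?iota_uniq// => i j /eqP; rewrite eqr_nat => /eqP.
- by rewrite size_map size_iota.
Qed.

Lemma poly_eq0_itvoo (lo hi : R) p :
  lo < hi -> {in `]lo, hi[, forall x, p.[x] = 0} -> p = 0.
Proof.
move=> lohi p0.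
(* The sample points are lo + (hi - lo) / (n + 2); the shift by 2 keeps the first one strictly below
   [hi]. *)
apply: (@roots_geq_poly_eq0 _ _
  [seq lo + (hi - lo) * (n.+2%:R)^-1 | n <- iota 0 (size p)]).
- apply/allP => _ /mapP[n _ ->]; rewrite rootE p0//.
  have d0 : 0 < hi - lo by rewrite subr_gt0.
  rewrite in_itv/= ltrDl mulr_gt0 ?invr_gt0//=.
  rewrite -ltrBrDl -[ltRHS]mulr1 ltr_pM2l// invf_lt1 ?ltr0n// ltr1n//.
- rewrite map_inj_uniq ?iota_uniq// => i j /addrI/mulfI.
  have d0 : hi - lo != 0 by rewrite subr_eq0 gt_eqF.
  by move=> /(_ d0)/invr_inj/eqP; rewrite eqr_nat => /eqP[].
- by rewrite size_map size_iota.
Qed.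

(** The factor 1 - x^2 is absorbed into the exponents, which are then positive for a, b > -1; hence
    the vanishing and the continuity at both ends. *)
Definition jacobi_flux a b H (x : R) : R :=
  (1 - x) `^ (a + 1) * (1 + x) `^ (b + 1) * H.[x].

Lemma is_derive_jacobi_flux a b H (x : R) : x \in `]-1, 1[ ->
  is_derive x 1 (jacobi_flux a b H)
    ((1 - x) `^ a * (1 + x) `^ b * (jraise a b H).[x]).
Proof.
rewrite in_itv/= => /andP[x0 x1].
have y0 : 0 < 1 - x by lra.
have z0 : 0 < 1 + x by lra.
have dl : is_derive x (1 : R) (fun x : R => 1 - x) (- 1).
  by apply: is_derive_eq; rewrite add0r mul1r.
have dr : is_derive x (1 : R) (fun x : R => 1 + x) 1.
  by apply: is_derive_eq; rewrite add0r mul1r.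
have dL := @is_derive1_comp R (fun y : R => y `^ (a + 1)) (fun y : R => 1 - y) x _ _
  (is_derive1_powR (a + 1) y0) dl.
have dR := @is_derive1_comp R (fun y : R => y `^ (b + 1)) (fun y : R => 1 + y) x _ _
  (is_derive1_powR (b + 1) z0) dr.
have dH := is_derive_poly H x.
have dG := is_deriveM (is_deriveM dL dR) dH.
apply: (@is_derive_eq _ _ _ _ _ _ _ _ dG).
rewrite /= !addrK.
have pl : (1 - x) `^ (a + 1) = (1 - x) * (1 - x) `^ a.
  rewrite powRD; last by rewrite (gt_eqF y0) implybT.
  by rewrite powRr1 1?ltW// mulrC.
have pr : (1 + x) `^ (b + 1) = (1 + x) * (1 + x) `^ b.
  rewrite powRD; last by rewrite (gt_eqF z0) implybT.
  by rewrite powRr1 1?ltW// mulrC.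
rewrite /jraise pl pr !hornerE /= fctE /= pl pr /GRing.scale/=; ring.
Qed.

Lemma cvg_powR_left1 a : 0 < a ->
  ((1 - x) `^ a @[x --> (1 : R)^'-] --> (0 : R))%classic.
Proof.
move=> a0 P HP; have P0 := @powR_cvg0 R a a0 P HP.
apply: (proj2 (nbhs_left0P (1 : R) (fun x => P ((1 - x) `^ a)))).
apply: (@filterS _ (0 : R)^'+%classic _ (fun e => P (e `^ a))) P0 => e.
by rewrite /= opprB addrC subrK.
Qed.

Lemma cvg_powR_rightN1 a : 0 < a ->
  ((1 + x) `^ a @[x --> (-1 : R)^'+] --> (0 : R))%classic.
Proof.
move=> a0 P HP; have P0 := @powR_cvg0 R a a0 P HP.
apply: (proj2 (nbhs_right0P (-1 : R) (fun x => P ((1 + x) `^ a)))).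
apply: (@filterS _ (0 : R)^'+%classic _ (fun e => P (e `^ a))) P0 => e.
by rewrite /= addrA subrr add0r.
Qed.

Lemma jacobi_flux1 a b H : -1 < a -> jacobi_flux a b H 1 = 0.
Proof.
by move=> a1; rewrite /jacobi_flux subrr powR0 ?mul0r//; rewrite gt_eqF//; lra.
Qed.

Lemma jacobi_fluxN1 a b H : -1 < b -> jacobi_flux a b H (-1) = 0.
Proof.
move=> b1; rewrite /jacobi_flux subrr powR0 ?mulr0 ?mul0r//.
by rewrite gt_eqF//; lra.
Qed.

Lemma continuous_jacobi_flux a b H : -1 < a -> -1 < b ->
  {within `[-1, 1], continuous (jacobi_flux a b H)}%classic.
Proof.
move=> a1 b1.
have a0 : 0 < a + 1 by lra.
have b0 : 0 < b + 1 by lra.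
have c (x c : R) : -1 < c -> 0 < x -> {for x, continuous (fun y => y `^ (c + 1))}.
  move=> c1 x0; apply: differentiable_continuous.
  by apply/derivable1_diffP; apply: derivable_powR; rewrite in_itv/= x0.
apply/continuous_within_itvP; first by lra.
split.
- move=> x xI; have [dG _] := is_derive_jacobi_flux a b H xI.
  by apply: differentiable_continuous; apply/derivable1_diffP.
- have cl :
      ((1 - x) `^ (a + 1) @[x --> (-1 : R)^'+] --> (1 - -1 : R) `^ (a + 1))%classic.
    apply: cvg_at_right_filter.
    apply: (@continuous_comp _ _ _ (fun x : R => 1 - x) (fun y => y `^ (a + 1))).
      by apply: cvgB; [exact: cvg_cst | exact: cvg_id].
    by apply: c => //; lra.
  have cH : (H.[x] @[x --> (-1 : R)^'+] --> H.[-1])%classic.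
    exact/cvg_at_right_filter/continuous_horner.
  have := cvgM (cvgM cl (cvg_powR_rightN1 b0)) cH.
  by rewrite mulr0 mul0r jacobi_fluxN1//; apply.
- have cl :
      ((1 + x) `^ (b + 1) @[x --> (1 : R)^'-] --> (1 + 1 : R) `^ (b + 1))%classic.
    apply: cvg_at_left_filter.
    apply: (@continuous_comp _ _ _ (fun x : R => 1 + x) (fun y => y `^ (b + 1))).
      by apply: cvgD; [exact: cvg_cst | exact: cvg_id].
    by apply: c => //; lra.
  have cH : (H.[x] @[x --> (1 : R)^'-] --> H.[1])%classic.
    exact/cvg_at_left_filter/continuous_horner.
  have := cvgM (cvgM (cvg_powR_left1 a0) cl) cH.
  by rewrite !mul0r jacobi_flux1//; apply.
Qed.

(** The flux is nondecreasing because its derivative is the weight times [jraise a b H]; as it is 0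
    at both ends, it is 0 throughout. The powers are positive inside the interval, so [H] vanishes
    there. *)
Lemma jraise_ge0 a b H : -1 < a -> -1 < b ->
  {in `]-1, 1[, forall x, 0 <= (jraise a b H).[x]} -> H = 0.
Proof.
move=> a1 b1 H0.
have G_nd : forall x y, -1 <= x -> x <= y -> y <= 1 ->
    jacobi_flux a b H x <= jacobi_flux a b H y.
  apply: ger0_derive1_ndecr; last exact: continuous_jacobi_flux.
    by move=> y /(is_derive_jacobi_flux a b H) [].
  move=> y yI; have dG := is_derive_jacobi_flux a b H yI.
  by rewrite derive1E derive_val !mulr_ge0 ?powR_ge0 ?H0.
apply: (@poly_eq0_itvoo (-1) 1); first by lra.
move=> x xI.
have /andP[x0 x1] : -1 < x < 1 by move: xI; rewrite in_itv.
have : jacobi_flux a b H x = 0.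
  apply/le_anti/andP; split.
    by rewrite -(jacobi_flux1 b H a1); apply: G_nd => //; exact: ltW.
  by rewrite -(jacobi_fluxN1 a H b1); apply: G_nd => //; exact: ltW.
move/eqP; rewrite !mulf_eq0 !powR_eq0 => /orP[/orP[]/andP[/eqP]|/eqP//]; lra.
Qed.

End Sign.

(** * From orthogonality to sign changes and simple zeros *)

Section Zeros.
Variable R : realType.
Implicit Types (a b : R) (p q v H g h : {poly R}).

Lemma poly_no_root_sign (lo hi : R) g : {in `]lo, hi[, forall x, ~~ root g x} ->
  {in `]lo, hi[, forall x, 0 <= g.[x]} \/ {in `]lo, hi[, forall x, 0 <= (- g).[x]}.
Proof.
move=> g0.
have ivt q x y : {in `]lo, hi[, forall z, ~~ root q z} ->
    x \in `]lo, hi[ -> y \in `]lo, hi[ -> x <= y -> ~ (q.[x] <= 0 <= q.[y]).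
  rewrite !in_itv/= => q0 /andP[xl _] /andP[_ yh] xy /(poly_ivt xy)[z].
  move=> /andP[xz zy]; apply/negP/q0.
  by rewrite in_itv/= (lt_le_trans xl)//= (le_lt_trans zy).
have gN0 : {in `]lo, hi[, forall z, ~~ root (- g) z}.
  by move=> z zI; rewrite rootN g0.
have [h|h] := pselect (exists2 x, x \in `]lo, hi[ & g.[x] < 0); last first.
  left=> x xI; rewrite leNgt; apply/negP => gx; apply: h; by exists x.
right=> y yI; rewrite hornerN oppr_ge0 leNgt; apply/negP => gy.
case: h => x xI gx; have [xy|/ltW yx] := leP x y.
  by apply: (ivt _ _ _ g0 xI yI xy); rewrite !ltW.
by apply: (ivt _ _ _ gN0 yI xI yx); rewrite !hornerN oppr_le0 oppr_ge0 !ltW.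
Qed.

(* S lists the points of ]lo, hi[ where p changes sign. *)
Lemma odd_roots_factorization (lo hi : R) p : p != 0 ->
  exists h g (S : seq R),
    [/\ p = h ^+ 2 * \prod_(x <- S) ('X - x%:P) * g, uniq S,
        {in S, forall x, x \in `]lo, hi[} & {in `]lo, hi[, forall x, ~~ root g x}].
Proof.
have [n] := ubnP (size p); elim: n p => // n IH p /ltnSE sp p0.
have [[x xI rx]|nr] := pselect (exists2 x, x \in `]lo, hi[ & root p x); last first.
  exists 1, p, [::]; split=> //; first by rewrite big_nil expr1n !mul1r.
  by move=> x xI; apply/negP => rx; apply: nr; exists x.
have /factor_theorem[p1 pE] := rx.
have p10 : p1 != 0 by apply: contraNneq p0 => p10; rewrite pE p10 mul0r.
have sp1 : (size p1 < n)%N.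
  by move: sp; rewrite pE size_Mmonic ?monicXsubC// size_XsubC addn2.
have [h [g [S [p1E uS SI g0]]]] := IH p1 sp1 p10.
(* A second occurrence of x forms a square, which moves to [h]; a first occurrence joins [S]. *)
have [xS|xS] := boolP (x \in S).
  exists (h * ('X - x%:P)), g, (rem x S); split=> //; last 2 first.
  - by rewrite rem_uniq.
  - by move=> y /mem_rem; apply: SI.
  rewrite pE p1E (perm_big _ (perm_to_rem xS)) big_cons/=; ring.
exists h, g, (x :: S); split=> //.
- by rewrite pE p1E big_cons; ring.
- by rewrite /= xS.
- by move=> y; rewrite inE => /predU1P[->//|]; apply: SI.
Qed.

Lemma mup_simple p q x : p = ('X - x%:P) * q -> ~~ root q x -> mup x p = 1%N.
Proof.
move=> -> qx; rewrite mupMl//.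
by have := mup_XsubCX 1 x x; rewrite expr1 eqxx.
Qed.

(** If |S| < K, orthogonality applies to the product over S, yet its product with p is (h P)^2 g, of
    constant sign. Hence |S| >= K. A point of S is a simple zero unless it is one of the at most deg
    h roots of h; since 2 deg h + |S| <= N, twice the number of simple zeros is at least 2 |S| - (N
    - |S|) >= 3 K - N. *)
Lemma zeros_lower_bound a b (K N : nat) p : -1 < a -> -1 < b -> p != 0 ->
    (size p <= N.+1)%N ->
    (forall q, (size q <= K)%N -> exists H, q * p = jraise a b H) ->
  (K <= nb_zeros p)%N /\ (3 * K <= 2 * nb_simple_zeros p + N)%N.
Proof.
move=> a1 b1 p0 sp orth.
have [h [g [S [pE uS SI g0]]]] := odd_roots_factorization (-1) 1 p0.
set P := \prod_(x <- S) ('X - x%:P) in pE.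
have [h0 gn0] : h != 0 /\ g != 0.
  by move: p0; rewrite pE !mulf_eq0 orbb !negb_or => /andP[/andP[->]].
have Pm : P \is monic by apply: monic_prod_XsubC.
have P0 : P != 0 by exact: monic_neq0.
have sP : size P = (size S).+1 by rewrite size_prod_XsubC.
have KS : (K <= size S)%N.
  rewrite leqNgt; apply/negP => SK.
  have [H pH] : exists H, P * p = jraise a b H by apply: orth; rewrite sP.
  have Ppn0 : P * p != 0 by rewrite mulf_neq0.
  have E : P * p = (h * P) ^+ 2 * g by rewrite pE; ring.
  have PpE x : (P * p).[x] = ((h * P).[x]) ^+ 2 * g.[x].
    by rewrite E hornerM horner_exp.
  have [gp|gp] := poly_no_root_sign g0.
    have H0 : H = 0.
      apply: (jraise_ge0 a1 b1) => x xI.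
      by rewrite -pH PpE mulr_ge0 ?sqr_ge0 ?gp.
    by move: Ppn0; rewrite pH H0 jraise0 eqxx.
  have H0 : - H = 0.
    apply: (jraise_ge0 a1 b1) => x xI.
    rewrite -scaleN1r jraiseZ scaleN1r -pH hornerN PpE -mulrN -hornerN.
    by rewrite mulr_ge0 ?sqr_ge0 ?gp.
  by move: Ppn0; rewrite pH -[H]opprK H0 oppr0 jraise0 eqxx.
have Sroots : {subset S <= roots p (-1) 1}.
  move=> x xS; rewrite in_roots p0 SI// !andbT pE rootE !hornerM.
  have : root P x by rewrite root_prod_XsubC.
  by move=> /rootP ->; rewrite mulr0 mul0r.
split.
  apply: leq_trans KS _; apply: leq_trans (uniq_leq_size uS Sroots) _.
  rewrite /nb_zeros -sum1_size !big_seq; apply: leq_sum => x.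
  by move=> /root_roots rx; rewrite -XsubC_dvd// dvdp_XsubCl.
have sh : (count (root h) S < size h)%N.
  rewrite -size_filter; apply: max_poly_roots; rewrite ?filter_uniq//.
  exact: filter_all.
have simple : (count (predC (root h)) S <= nb_simple_zeros p)%N.
  rewrite /nb_simple_zeros -!size_filter; apply: uniq_leq_size.
    by rewrite filter_uniq.
  move=> x; rewrite !mem_filter/= => /andP[hx xS]; rewrite Sroots// andbT.
  apply/eqP; apply: (@mup_simple _ (h ^+ 2 * \prod_(y <- rem x S) ('X - y%:P) * g)).
    by rewrite pE /P (perm_big _ (perm_to_rem xS)) big_cons/=; ring.
  rewrite !rootM negb_or g0 ?SI// andbT orbb negb_or hx/=.
  by rewrite root_prod_XsubC mem_rem_uniqF.
have g1 : (0 < size g)%N by rewrite lt0n size_poly_eq0.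
have szp : (size p = 2 * (size h).-1 + size S + size g)%N.
  rewrite pE !size_mul ?mulf_neq0// ?sqrf_eq0// sP.
  have : (0 < size h)%N by rewrite lt0n size_poly_eq0.
  by move: g1; move: (size h) (size g) (size S) => x y z; lia.
have cS := count_predC (root h) S.
move: KS sh simple szp sp g1 cS.
move: (size h) (size g) (size S) (size p) (nb_simple_zeros p) => sh sg sS sp ns.
move: (count _ S) (count _ S) => c1 c2.
lia.
Qed.
End Zeros.

(** * Determinants of Wronskian type, expanded over monomials *)

(** The bound is 0 + 1 + ... + (|A| - 1). The largest value is at least |A| - 1, because |A|
    distinct naturals lie below or at it; remove it and induct. *)
Lemma sum_injective_ge (T : finType) (A : {set T}) (f : T -> nat) :
  {in A &, injective f} -> ('C(#|A|, 2) <= \sum_(i in A) f i)%N.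
Proof.
have [n] := ubnP #|A|; elim: n A => // n IH A /ltnSE An fI.
have [->|[x0 x0A]] := set_0Vmem A; first by rewrite cards0.
case: (arg_maxnP f x0A) => x xA xmax; have {}xA : x \in A by [].
rewrite (big_setD1 x)//= (cardsD1 x) xA add1n binS bin1 addnC leq_add//; last first.
  apply: IH; first by move: An; rewrite (cardsD1 x) xA.
  by move=> y z; rewrite !inE => /andP[_ yA] /andP[_ zA]; apply: fI.
have : (size [seq f i | i in A] <= size (iota 0 (f x).+1))%N.
  apply: uniq_leq_size.
    rewrite map_inj_in_uniq ?enum_uniq// => y z.
    by rewrite !mem_enum; apply: fI.
  by move=> _ /mapP[y + ->]; rewrite mem_enum mem_iota/= ltnS; apply: xmax.
by rewrite size_map size_iota -cardE (cardsD1 x) xA.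
Qed.

Section EulerWronskian.
Variable R : numFieldType.
Implicit Types (y g : R) (p q : {poly R}).

(** Falling factorial: the i-th derivative of t^y is [ffactr y i] times t^(y - i). *)
Definition ffactr y (i : nat) : R := \prod_(l < i) (y - l%:R).

Lemma ffactr_nat (k i : nat) : ffactr k%:R i = (k ^_ i)%:R.
Proof.
elim: i => [|i IH]; first by rewrite /ffactr big_ord0 ffactn0.
rewrite /ffactr big_ord_recr/= -/(ffactr _ _) IH ffactnSr natrM.
have [ik|ki] := leqP i k; first by rewrite natrB.
by rewrite ffact_small// !mul0r.
Qed.

Definition ffact_poly (i : nat) : {poly R} := \prod_(l < i) ('X - (l%:R)%:P).

Lemma horner_ffact_poly i y : (ffact_poly i).[y] = ffactr y i.
Proof. by rewrite horner_prod; apply: eq_bigr => l _; rewrite hornerXsubC. Qed.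

Lemma size_ffact_poly i : size (ffact_poly i) = i.+1.
Proof. by rewrite size_prod_XsubC -[X in size X]enumT size_enum_ord. Qed.

Lemma monic_ffact_poly i : ffact_poly i \is monic.
Proof. exact: monic_prod_XsubC. Qed.

(** Falling factorials are monic of degree i, so the matrix is a Vandermonde matrix times a
    unitriangular one. *)
Lemma det_ffactr_neq0 n (y : 'I_n -> R) : injective y ->
  \det (\matrix_(c < n, i < n) ffactr (y c) i) != 0.
Proof.
move=> yI; pose B := \matrix_(i < n, k < n) (ffact_poly i)`_k.
have -> : \matrix_(c < n, i < n) ffactr (y c) i =
    (Vandermonde n (\row_c y c))^T *m B^T.
  apply/matrixP => c i; rewrite !mxE -horner_ffact_poly.
  rewrite (@horner_coef_wide _ n) ?size_ffact_poly//.
  by apply: eq_bigr => k _; rewrite !mxE mulrC.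
rewrite det_mulmx !det_tr det_Vandermonde mulf_neq0//.
  apply/prodf_neq0 => i _; apply/prodf_neq0 => j ij; rewrite !mxE subr_eq0.
  by apply: contraTneq ij => /yI ->; rewrite ltnn.
rewrite det_trig; last first.
  by apply/is_trig_mxP => i j ij; rewrite mxE nth_default// size_ffact_poly.
rewrite big1 ?oner_neq0// => i _; rewrite mxE.
by have /monicP := monic_ffact_poly i; rewrite lead_coefE size_ffact_poly.
Qed.

(* [t ^ (g - i) * (euler g i p).[t]] is the i-th derivative of
   [t ^ g * p.[t]]. *)
Definition euler g (i : nat) p : {poly R} :=
  \poly_(k < size p) (p`_k * ffactr (g + k%:R) i).

Lemma coef_euler g i p k : (euler g i p)`_k = p`_k * ffactr (g + k%:R) i.
Proof.
by rewrite coef_poly; case: ltnP => // pk; rewrite nth_default ?mul0r.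
Qed.

Lemma euler0_derivn i p : euler 0 i p = 'X^i * p^`(i).
Proof.
apply/polyP => k; rewrite coef_euler add0r coefXnM ffactr_nat.
have [ki|ik] := ltnP k i; first by rewrite ffact_small// mulr0.
by rewrite coef_derivn subnKC// mulr_natr.
Qed.

(** Transposed Wronskian matrix of the functions t^(g c) p_c(t), with t^(g c) taken out of row c and
    t^(-i) out of column i. *)
Definition euler_mx n (g : 'I_n -> R) (p : 'I_n -> {poly R}) : 'M[{poly R}]_n :=
  \matrix_(c, i) euler (g c) i (p c).

(** Multilinearity in the rows: [f] chooses one monomial in each row. *)
Lemma det_euler_mxE n (g : 'I_n -> R) (p : 'I_n -> {poly R}) (N : nat) :
    (forall c, size (p c) <= N)%N ->
  \det (euler_mx g p) = \sum_(f : {ffun 'I_n -> 'I_N})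
     (\prod_c (p c)`_(f c) *
      \det (\matrix_(c, i) ffactr (g c + (f c)%:R) i)) *:
        'X^(\sum_c f c).
Proof.
move=> pN; rewrite /determinant.
transitivity (\sum_(s : 'S_n) \sum_(f : {ffun 'I_n -> 'I_N})
   (((-1) ^+ s * \prod_c ((p c)`_(f c) * ffactr (g c + (f c)%:R) (s c))) *:
     'X^(\sum_c f c)) : {poly R}).
  apply: eq_bigr => s _.
  pose F (c : 'I_n) (k : 'I_N) : {poly R} :=
    ((p c)`_k * ffactr (g c + k%:R) (s c)) *: 'X^k.
  rewrite (eq_bigr (fun c => \sum_k F c k)); last first.
    move=> c _; rewrite mxE /F.
    rewrite -(poly_def N (fun k => (p c)`_k * ffactr (g c + k%:R) (s c))).
    apply/polyP => k; rewrite coef_euler coef_poly.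
    by case: ltnP => // Nk; rewrite nth_default ?mul0r// (leq_trans (pN c)).
  rewrite bigA_distr_bigA mulr_sumr/=; apply: eq_bigr => f _.
  rewrite /F expr_sum -mul_polyC polyCM rmorph_prod/= rmorph_sign
     -mulrA -big_split/=.
  by congr (_ * _); apply: eq_bigr => c _; rewrite -mul_polyC.
rewrite exchange_big; apply: eq_bigr => f _.
rewrite -scaler_suml mulr_sumr; congr (_ *: _); apply: eq_bigr => s _.
rewrite big_split/= mulrCA; congr (_ * (_ * _)).
by apply: eq_bigr => c _; rewrite mxE.
Qed.

Lemma coef_det_euler_mx n (g : 'I_n -> R) (p : 'I_n -> {poly R}) (N e : nat) :
    (forall c, size (p c) <= N)%N ->
  (\det (euler_mx g p))`_e = \sum_(f : {ffun 'I_n -> 'I_N} | (\sum_c f c == e)%N)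
     (\prod_c (p c)`_(f c) *
      \det (\matrix_(c, i) ffactr (g c + (f c)%:R) i)).
Proof. by move=> /det_euler_mxE ->; rewrite !coefE. Qed.

(** If [f] takes the same value at two indices of one class, two rows coincide and the term is 0.
    Otherwise [f] is injective on both classes and [sum_injective_ge] bounds its sum from below. *)
Lemma coef_det_euler_mx_low n (g : 'I_n -> R) (p : 'I_n -> {poly R})
    (A : {set 'I_n}) (e : nat) :
    {in A &, forall c c', g c = g c'} -> {in ~: A &, forall c c', g c = g c'} ->
  (e < 'C(#|A|, 2) + 'C(#|~: A|, 2))%N -> (\det (euler_mx g p))`_e = 0.
Proof.
move=> gA gA' ed.
rewrite (@coef_det_euler_mx _ _ _ (\max_c size (p c))); last first.
  by move=> c; rewrite (leq_bigmax c).
rewrite big1// => f /eqP fe.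
suff [c [c' [cc' gcc' fcc']]] : exists c c', [/\ c != c', g c = g c' & f c = f c'].
  rewrite (determinant_alternate cc') ?mulr0// => i.
  by rewrite !mxE gcc' fcc'.
apply: contrapT => nex.
have inj (B : {set 'I_n}) : {in B &, forall c c', g c = g c'} ->
    {in B &, injective (fun c => f c : nat)}.
  move=> gB c c' cB c'B /= /val_inj fcc'; apply/eqP; apply: contraPT isT => cc' _.
  by apply: nex; exists c, c'; rewrite (gB c c').
have := leq_add (sum_injective_ge (inj _ gA)) (sum_injective_ge (inj _ gA')).
rewrite leqNgt => /negP; apply; apply: leq_trans ed.
rewrite -fe ltnS [X in (_ <= X)%N](bigID (mem A))/= leq_add//.
by rewrite (eq_bigl (fun c => c \notin A))// => c; rewrite inE.
Qed.

(** A nonzero product forces f <= D pointwise, and the inequality of the sums then forces equality.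
    So only f = D reaches the top degree. *)
Lemma prod_coef_high n (p : 'I_n -> {poly R}) (D : 'I_n -> nat) (f : 'I_n -> nat) :
    (forall c, size (p c) <= (D c).+1)%N ->
    (\sum_c D c <= \sum_c f c)%N -> \prod_c (p c)`_(f c) != 0 ->
  forall c, f c = D c.
Proof.
move=> pD fD /prodf_neq0 p0.
have fleD c : (f c <= D c)%N.
  rewrite leqNgt; apply/negP => Df; move: (p0 c isT).
  by rewrite nth_default ?eqxx// (leq_trans (pD c)).
move=> c; apply/eqP; rewrite eqn_leq fleD/= leqNgt; apply/negP => fcD.
move: fD; rewrite leqNgt => /negP; apply.
rewrite (bigD1 c)//= [X in (_ < X)%N](bigD1 c)//= -addSn leq_add//.
by apply: leq_sum => c' _.
Qed.

Lemma size_det_euler_mx n (g : 'I_n -> R) (p : 'I_n -> {poly R}) (D : 'I_n -> nat) :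
    (forall c, size (p c) <= (D c).+1)%N ->
  (size (\det (euler_mx g p)) <= (\sum_c D c).+1)%N.
Proof.
move=> pD; apply/leq_sizeP => e De.
rewrite (@coef_det_euler_mx _ _ _ (\max_c size (p c))); last first.
  by move=> c; rewrite (leq_bigmax c).
rewrite big1// => f /eqP fe; have [->|p0] := eqVneq (\prod_c (p c)`_(f c)) 0.
  by rewrite mul0r.
have := @prod_coef_high _ _ _ (fun c => f c) pD _ p0.
rewrite fe (ltnW De) => /(_ isT) fD.
by move: De; rewrite -fe [X in (_ < X)%N](eq_bigr D) ?ltnn.
Qed.

Lemma coef_det_euler_mx_top n (g : 'I_n -> R) (p : 'I_n -> {poly R})
    (D : 'I_n -> nat) :
    (forall c, size (p c) <= (D c).+1)%N ->
  (\det (euler_mx g p))`_(\sum_c D c) =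
    \prod_c (p c)`_(D c) * \det (\matrix_(c, i) ffactr (g c + (D c)%:R) i).
Proof.
move=> pD; pose N := (\max_c (D c).+1)%N.
have DN c : (D c < N)%N by rewrite (leq_bigmax c).
rewrite (@coef_det_euler_mx _ _ _ N); last first.
  by move=> c; rewrite (leq_trans (pD c)).
rewrite (bigD1 [ffun c => Ordinal (DN c)])/=; last first.
  by apply/eqP; apply: eq_bigr => c _; rewrite ffunE.
rewrite [X in _ + X]big1 ?addr0.
  congr (_ * _); first by apply: eq_bigr => c _; rewrite ffunE.
  by congr (\det _); apply/matrixP => c i; rewrite !mxE ffunE.
move=> f /andP[/eqP fe fneq].
have [->|p0] := eqVneq (\prod_c (p c)`_(f c)) 0; first by rewrite mul0r.
have fD := @prod_coef_high _ _ _ (fun c => f c) pD _ p0.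
case/eqP: fneq; apply/ffunP => c; rewrite ffunE; apply: val_inj.
by rewrite /= fD// fe.
Qed.

Definition with_last r (p : 'I_r.+1 -> {poly R}) (y : {poly R}) c : {poly R} :=
  if c == ord_max then y else p c.

(** Expansion along the last row. The cofactors ignore that row, so they can be computed with 0 in
    it: the determinant is a differential operator in [y]. *)
Lemma det_euler_mx_with_last r (g : 'I_r.+1 -> R) (p : 'I_r.+1 -> {poly R})
    (y : {poly R}) :
    g ord_max = 0 ->
  \det (euler_mx g (with_last p y)) =
    \sum_(i < r.+1) 'X^i * y^`(i) * cofactor (euler_mx g (with_last p 0)) ord_max i.
Proof.
move=> g0; rewrite (expand_det_row _ ord_max); apply: eq_bigr => i _.
rewrite mxE /with_last eqxx g0 euler0_derivn; congr (_ * (_ * \det _)).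
apply/matrixP => c k; rewrite !mxE.
by rewrite -[lift _ _ == _]eq_sym (negPf (neq_lift _ _)).
Qed.

(* The Q i are found by taking y = 'X^0, 'X^1, ... in turn. *)
Lemma euler_mx_operator r (g : 'I_r.+1 -> R) (p : 'I_r.+1 -> {poly R})
    (D : 'I_r.+1 -> nat) (d C : nat) :
    g ord_max = 0 ->
    (forall (y : {poly R}) e, (e < d)%N ->
       (\det (euler_mx g (with_last p y)))`_e = 0) ->
    (forall c, c != ord_max -> size (p c) <= (D c).+1)%N ->
    (C + d = \sum_(c | c != ord_max) D c)%N ->
  exists Q : nat -> {poly R}, (forall i : 'I_r.+1, (size (Q i) <= (C + i).+1)%N) /\
    forall y : {poly R}, \det (euler_mx g (with_last p y)) =
      'X^d * \sum_(i < r.+1) Q i * y^`(i).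
Proof.
move=> g0 low pD Cd; pose W (y : {poly R}) := \det (euler_mx g (with_last p y)).
pose cof i := cofactor (euler_mx g (with_last p 0)) ord_max i.
have WE (y : {poly R}) : W y = \sum_(i < r.+1) 'X^i * y^`(i) * cof i.
  exact: det_euler_mx_with_last.
have Wd (y : {poly R}) : W y = 'X^d * drop_poly d (W y).
  rewrite -{1}(poly_take_drop d (W y)) [X in X + _](_ : _ = 0) ?add0r 1?mulrC//.
  by apply/polyP => e; rewrite coef_take_poly coef0; case: ifP => // ed; apply: low.
(* The determinant has degree at most C + d + k, the last row contributing k, and division by X^d
   removes d. *)
have sW (k : nat) : (size (drop_poly d (W 'X^k)) <= (C + k).+1)%N.
  rewrite size_drop_poly leq_subLR.
  have := @size_det_euler_mx _ g (with_last p 'X^k)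
    (fun c => if c == ord_max then k else D c) _.
  rewrite -/(W _) (bigD1 ord_max)//= eqxx.
  rewrite (eq_bigr D); last by move=> c /negPf ->.
  rewrite -Cd => H; apply: leq_trans (H _) _; last by lia.
  by move=> c; rewrite /with_last; case: eqP => [_|/eqP/pD//]; rewrite size_polyXn.
(* On X^k the operator stops at i = k, where its term is k! X^k times the k-th cofactor; the terms
   with i < k are known by strong induction, so this one can be solved for. *)
have key (k : nat) : (k <= r)%N -> exists Q : {poly R},
    (size Q <= (C + k).+1)%N /\ 'X^k * cof (inord k) = 'X^d * Q.
  have [n] := ubnP k; elim: n k => // n IH k /ltnSE kn kr.
  have /choice[Q HQ] : forall i : 'I_k, exists Q : {poly R},
      (size Q <= (C + i).+1)%N /\ 'X^i * cof (inord i) = 'X^d * Q.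
    move=> i; apply: IH; first exact: leq_trans (ltn_ord i) kn.
    exact: leq_trans (ltnW (ltn_ord i)) kr.
  have fact0 : (k`!)%:R != 0 :> R by rewrite pnatr_eq0 -lt0n fact_gt0.
  exists (k`!%:R^-1 *: (drop_poly d (W 'X^k) -
    \sum_(i < k) (k ^_ i)%:R *: ('X^(k - i) * Q i))); split.
    rewrite (leq_trans (size_scale_leq _ _))//.
    rewrite (leq_trans (size_polyD _ _))// geq_max sW size_polyN/=.
    apply: leq_trans (size_sum _ _ _) _; apply/bigmax_leqP => i _.
    rewrite (leq_trans (size_scale_leq _ _))// (leq_trans (size_polyMleq _ _))//.
    have [sQ _] := HQ i; have := ltn_ord i; rewrite size_polyXn.
    lia.
  have := WE 'X^k; rewrite {1}Wd => WXk.
  rewrite -scalerAr mulrBr WXk.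
  apply: (canRL (scalerK fact0)).
  pose F i : {poly R} := 'X^i * 'X^k^`(i) * cof (inord i).
  have -> : \sum_(i < r.+1) 'X^i * 'X^k^`(i) * cof i = \sum_(i < k) F i + F k.
    transitivity (\sum_(i < r.+1) F i).
      by apply: eq_bigr => i _; rewrite /F inord_val.
    rewrite -(big_mkord xpredT) (@big_cat_nat _ _ _ k.+1)//=.
    rewrite big_nat_recr//= big_mkord.
    rewrite [X in _ + X]big_nat_cond [X in _ + X]big1 ?addr0// => i.
    rewrite andbT => /andP[ki _].
    by rewrite /F derivnXn ffact_small// mulr0n mulr0 mul0r.
  rewrite mulr_sumr addrAC -sumrB big1 ?add0r => [|i _].
    by rewrite /F derivnXn subnn expr0 ffactnn mulrnAr mulr1 mulrnAl scaler_nat.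
  have [_ E] := HQ i.
  rewrite /F derivnXn mulrnAr mulrnAl mulrAC E -scalerAr scaler_nat.
  by apply/eqP; rewrite subr_eq0; apply/eqP; congr (_ *+ _); ring.
have /choice[Q HQ] : forall k : nat, exists Q : {poly R}, (k <= r)%N ->
    (size Q <= (C + k).+1)%N /\ 'X^k * cof (inord k) = 'X^d * Q.
  move=> k; have [/key[Q HQ]|_] := leqP k r; last by exists 0.
  by exists Q.
exists Q; split=> [i|y]; first by have [|//] := HQ i; rewrite -ltnS.
rewrite -/(W y) WE mulr_sumr; apply: eq_bigr => i _.
have [|_] := HQ i; first by rewrite -ltnS.
by rewrite inord_val => E; rewrite mulrA -E; ring.
Qed.
End EulerWronskian.

(** * Wronskians of functions (1 + x)^g q(1 + x) *)

Section Wronskians.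
Variable R : realType.
Implicit Types (g x : R) (p q : {poly R}).

Lemma eulerS g (i : nat) q :
  euler g i.+1 q = (g - i%:R) *: euler g i q + 'X * (euler g i q)^`().
Proof.
apply/polyP => k; rewrite coefD coefZ coefXM !coef_euler /ffactr big_ord_recr/=.
case: k => [|k] /=; first by ring.
rewrite coef_deriv coef_euler -mulr_natr /ffactr; ring.
Qed.

Lemma is_derive_powR_poly g q x : -1 < x ->
  is_derive x 1 (fun y : R => (1 + y) `^ g * q.[1 + y])
    ((1 + x) `^ (g - 1) * (g *: q + 'X * q^`()).[1 + x]).
Proof.
move=> x1; have z0 : 0 < 1 + x by lra.
have dr : is_derive x (1 : R) (fun x : R => 1 + x) 1.
  by apply: is_derive_eq; rewrite add0r mul1r.
have dP := @is_derive1_comp R (fun y : R => y `^ g) (fun y : R => 1 + y) x _ _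
  (is_derive1_powR g z0) dr.
have dQ := @is_derive1_comp R (horner q) (fun y : R => 1 + y) x _ _
  (is_derive_poly q (1 + x)) dr.
have dG := is_deriveM dP dQ.
apply: (@is_derive_eq _ _ _ _ _ _ _ _ dG).
have pr : (1 + x) `^ g = (1 + x) * (1 + x) `^ (g - 1).
  rewrite -{1}[g](subrK 1) (@powRD R (1 + x) (g - 1) 1); last first.
    by rewrite (gt_eqF z0) implybT.
  by rewrite powRr1 1?ltW// mulrC.
by rewrite !hornerE /= /GRing.scale/= pr; ring.
Qed.

Lemma derive1n_powR_poly (f : R -> R) g q (i : nat) :
    (forall x, -1 < x -> f x = (1 + x) `^ g * q.[1 + x]) ->
  forall x, -1 < x ->
    derive1n i f x = (1 + x) `^ (g - i%:R) * (euler g i q).[1 + x].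
Proof.
move=> fE; elim: i => [|i IH] x x1.
  rewrite derive1n0 fE// subr0; congr (_ * _.[_]).
  by apply/polyP => k; rewrite coef_euler /ffactr big_ord0 mulr1.
rewrite derive1nS derive1E.
rewrite (@near_eq_derive _ _ _ _
  (fun y : R => (1 + y) `^ (g - i%:R) * (euler g i q).[1 + y])); last first.
  (* The formula for the i-th derivative holds only on the open half-line, which suffices to
     differentiate it at x. *)
  have : \forall y \near x, -1 < y by exact: lt_nbhsr.
  by apply: filterS => y; apply: IH.
have dG := is_derive_powR_poly (g - i%:R) (euler g i q) x1.
by rewrite derive_val -eulerS -natr1 opprD addrA.
Qed.

Lemma prod_powR_sum n (F : 'I_n -> R) x : 0 < x ->
  \prod_i x `^ (F i) = x `^ (\sum_i F i).
Proof.
move=> x0; rewrite (big_morph (fun e => x `^ e) (id1 := 1) (op1 := *%R))//.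
  by move=> e e'; rewrite powRD// (gt_eqF x0) implybT.
by rewrite powRr0.
Qed.

(** The powers of 1 + x factor out as two diagonal matrices; the exponents -i of the derivative
    orders add up to -'C(n, 2). *)
Lemma wronskian_euler n (gs : seq (R -> R)) (g : 'I_n -> R)
    (p : 'I_n -> {poly R}) x :
    size gs = n -> -1 < x ->
    (forall (j : 'I_n) y, -1 < y ->
       nth (fun=> 0) gs j y = (1 + y) `^ (g j) * (p j).[1 + y]) ->
  wronskian gs x =
    (1 + x) `^ (\sum_j g j - 'C(n, 2)%:R) * (\det (euler_mx g p)).[1 + x].
Proof.
move=> sn x1 gsE; subst n; have z0 : 0 < 1 + x by lra.
rewrite /wronskian -det_tr.
have -> : (\matrix_(i < size gs, j < size gs) derive1n i (nth (fun=> 0) gs j) x)^T =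
    diag_mx (\row_j (1 + x) `^ (g j)) *m
    map_mx (horner_eval (1 + x)) (euler_mx g p) *m
    diag_mx (\row_i (1 + x) `^ (- (i%:R))).
  rewrite mul_mx_diag mul_diag_mx; apply/matrixP => j i; rewrite !mxE.
  rewrite (derive1n_powR_poly _ (gsE j))// powRD; last first.
    by rewrite (gt_eqF z0) implybT.
  by rewrite /horner_eval; ring.
rewrite !det_mulmx !det_diag det_map_mx.
under eq_bigr do rewrite mxE.
under [X in _ * _ * X]eq_bigr do rewrite mxE.
rewrite !prod_powR_sum// mulrAC -powRD; last by rewrite (gt_eqF z0) implybT.
by rewrite /horner_eval sumrN -natr_sum -bin2_sum big_mkord.
Qed.

End Wronskians.

(** * Partitions and their strictly decreasing sequences *)

Lemma bin2D m n : 'C(m + n, 2) = ('C(m, 2) + 'C(n, 2) + m * n)%N.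
Proof.
elim: n => [|n IH]; first by rewrite addn0 muln0 !addn0.
by rewrite addnS !binS !bin1 IH mulnS; lia.
Qed.

Lemma sum_assoc la : (\sum_(i < size la) assoc la i = sumn la + 'C(size la, 2))%N.
Proof.
rewrite /assoc big_split/=; congr (_ + _)%N.
  by rewrite sumnE (big_nth 0%N) big_mkord.
rewrite -bin2_sum big_mkord (reindex_inj rev_ord_inj)/=.
by apply: eq_bigr => i _; rewrite subnSK// subKn// ltnW.
Qed.

Lemma size_partition_le la : is_partition la -> (size la <= sumn la)%N.
Proof.
move=> /andP[_]; elim: la => //= k la IH /andP[k0 /IH]; rewrite -add1n.
exact: leq_add.
Qed.

Lemma assoc_lt la (i j : nat) : is_partition la ->
  (i < j < size la)%N -> (assoc la j < assoc la i)%N.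
Proof.
move=> /andP[sla _] /andP[ij js].
have := sorted_leq_nth (leT := geq) _ _ 0%N sla; move=> /(_ _ _ i j).
rewrite /assoc => H.
have : (nth 0 la j <= nth 0 la i)%N.
  apply: H => //.
  - by move=> y x z xy yz; exact: leq_trans yz xy.
  - by move=> x; exact: leqnn.
  - by rewrite inE (ltn_trans ij).
  - exact: ltnW.
by lia.
Qed.

Lemma assoc_inj la (i j : nat) : is_partition la ->
  (i < size la)%N -> (j < size la)%N -> assoc la i = assoc la j -> i = j.
Proof.
move=> hla il jl E; case: (ltngtP i j) => // ij.
  by have := @assoc_lt la i j hla; rewrite ij jl E ltnn => /(_ isT).
by have := @assoc_lt la j i hla; rewrite ij il E ltnn => /(_ isT).
Qed.

(** * The seed functions in the variable t = 1 + x *)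

Section SeedColumns.
Variables (R : realType) (alpha beta : R) (la mu : seq nat).
Let r1 := size la.
Let r2 := size mu.
Let r := (r1 + r2)%N.

Definition seed_exponent (c : 'I_r.+1) : R :=
  if (r1 <= c < r)%N then - beta else 0.

Definition seed_degree (c : 'I_r.+1) : nat :=
  if (c < r1)%N then assoc la c else assoc mu (c - r1).

(** Composition with X - 1 passes to t = 1 + x. The entry at [ord_max] is a placeholder, overwritten
    by [with_last]. *)
Definition seed_poly (c : 'I_r.+1) : {poly R} :=
  (if (c < r1)%N then jacobi alpha beta (assoc la c)
   else jacobi alpha (- beta) (assoc mu (c - r1))) \Po ('X - 1).

(* The columns 0, ..., r1 - 1 and the last one, which holds P_s: their
   exponent of 1 + x is 0. *)
Definition first_kind : {set 'I_r.+1} := [set c : 'I_r.+1 | ~~ (r1 <= c < r)%N].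

Lemma card_first_kind : #|first_kind| = r1.+1.
Proof.
rewrite -sum1dep_card big_mkcond.
rewrite -(big_mkord xpredT (fun c : nat => if ~~ (r1 <= c < r)%N then 1%N else 0%N)).
rewrite (@big_cat_nat _ _ _ r1)//=; last by rewrite /r -addnS leq_addr.
rewrite (big_nat_recr r)/=; last exact: leq_addr.
rewrite (eq_big_nat _ _ (F2 := fun=> 1%N)); last first.
  by move=> i /andP[_ ir]; rewrite leqNgt ir.
rewrite [X in (_ + (X + _))%N]big_nat_cond [X in (_ + (X + _))%N]big1; last first.
  by move=> i /andP[->].
by rewrite sum_nat_const_nat ltnn andbF/=; lia.
Qed.

Lemma card_first_kindC : #|~: first_kind| = r2.
Proof.
have := cardsC first_kind; rewrite card_first_kind card_ord /r => /eqP.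
by rewrite addSn eqSS eqn_add2l => /eqP.
Qed.

Lemma sum_seed_exponent : \sum_c seed_exponent c = - beta * r2%:R.
Proof.
rewrite (bigID (mem first_kind))/= big1 ?add0r; last first.
  by move=> c; rewrite inE /seed_exponent => /negPf ->.
rewrite -card_first_kindC.
rewrite (eq_bigr (fun=> - beta)); last first.
  by move=> c; rewrite inE negbK /seed_exponent => ->.
rewrite (eq_bigl (mem (~: first_kind))); last by move=> c; rewrite /= !inE.
by rewrite sumr_const mulr_natr.
Qed.

Lemma seed_exponent_max : seed_exponent ord_max = 0.
Proof. by rewrite /seed_exponent /= ltnn andbF. Qed.

Lemma size_seed_poly c : (size (seed_poly c) <= (seed_degree c).+1)%N.
Proof.
rewrite /seed_poly /seed_degree size_comp_poly2 ?size_XsubC//.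
by case: ifP => _; apply: size_jacobi_leq.
Qed.

Lemma sum_seed_degree :
  (\sum_(c < r.+1 | c != ord_max) seed_degree c =
   sumn la + 'C(r1, 2) + (sumn mu + 'C(r2, 2)))%N.
Proof.
rewrite big_mkcond big_ord_recr/= eqxx addn0.
rewrite (eq_bigr (fun c : 'I_r => 
   if (c < r1)%N then assoc la c else assoc mu (c - r1))); last first.
  by move=> c _; rewrite -val_eqE/= ltn_eqF.
rewrite -sum_assoc -[(sumn mu + _)%N]sum_assoc /r big_split_ord/=.
congr (_ + _)%N; apply: eq_bigr => i _; first by rewrite ltn_ord.
by rewrite ltnNge leq_addr/= addKn.
Qed.

Lemma nth_seed_functions (Y : {poly R}) (c : 'I_r.+1) x : -1 < x ->
  nth (fun=> 0) (rcons (seed_functions alpha beta la mu) (horner Y)) c x =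
  (1 + x) `^ (seed_exponent c) *
    (with_last seed_poly (Y \Po ('X - 1)) c).[1 + x].
Proof.
move=> x1; have z0 : 0 < 1 + x by lra.
have comp q : (q \Po ('X - 1)).[1 + x] = q.[x].
  by rewrite horner_comp !hornerE addrC addKr.
have sz : size (seed_functions alpha beta la mu) = r.
  by rewrite size_cat !size_map !size_iota.
rewrite nth_rcons sz /with_last -val_eqE/= /seed_poly /seed_exponent.
case: ltngtP => [cr|rc|_]; last first.
- by rewrite andbF powRr0 mul1r comp.
- by have := ltn_ord c; rewrite ltnS leqNgt rc.
rewrite andbT nth_cat size_map size_iota -/r1 comp.
have [cr1|r1c] := ltnP c r1.
  by rewrite powRr0 mul1r (nth_map 0%N) ?size_iota// nth_iota.
rewrite (nth_map 0%N) ?size_iota ?nth_iota ?add0n//.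
all: by rewrite ltn_subLR.
Qed.

End SeedColumns.

(** * The exceptional polynomial as a differential operator applied to P_s *)

Section ExceptionalJacobi.
Variables (R : realType) (alpha beta : R) (la mu : seq nat).
Hypothesis hla : is_partition la.
Let r1 := size la.
Let r2 := size mu.
Let r := (r1 + r2)%N.
Let C := (sumn la + sumn mu - r1)%N.
Let d := ('C(r1.+1, 2) + 'C(r2, 2))%N.
Let seed_mx (Y : {poly R}) := euler_mx (@seed_exponent R beta la mu)
  (with_last (@seed_poly R alpha beta la mu) (Y \Po ('X - 1))).

Lemma derivn_comp_XsubC (Y : {poly R}) i c :
  (Y \Po ('X - c%:P))^`(i) = Y^`(i) \Po ('X - c%:P).
Proof.
elim: i => // i IH.
by rewrite !derivnS IH deriv_comp derivB derivX derivC subr0 mulr1.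
Qed.

(** The order d of vanishing at t = 0 comes from the two classes of exponents, with r1 + 1 and r2
    members; the degrees of the seeds add up to C + d. *)
Lemma seed_operator_t : exists Q : nat -> {poly R},
  (forall i : 'I_r.+1, (size (Q i) <= (C + i).+1)%N) /\
  forall Y : {poly R}, \det (seed_mx Y) =
    'X^d * \sum_(i < r.+1) Q i * (Y \Po ('X - 1))^`(i).
Proof.
have [||||Q [sQ QE]] := @euler_mx_operator _ r (@seed_exponent R beta la mu)
  (@seed_poly R alpha beta la mu) (@seed_degree la mu) d C.
- exact: seed_exponent_max.
- move=> Y e ed; apply: (@coef_det_euler_mx_low _ _ _ _ (first_kind la mu)).
  + by move=> c c'; rewrite !inE /seed_exponent => /negPf -> /negPf ->.
  + by move=> c c'; rewrite !inE !negbK /seed_exponent => -> ->.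
  + by rewrite card_first_kind card_first_kindC.
- by move=> c _; apply: size_seed_poly.
- rewrite sum_seed_degree /C /d binS bin1.
  have := size_partition_le hla; rewrite -/r1 -/r2; lia.
by exists Q; split=> // Y; apply: QE.
Qed.

Lemma seed_operator : exists Q : nat -> {poly R},
  [/\ forall i : 'I_r.+1, (size (Q i) <= (C + i).+1)%N,
    forall (Y : {poly R}) (x : R), -1 < x ->
      (1 + x) `^ ((beta + r1%:R + 1) * r2%:R) *
        wronskian (rcons (seed_functions alpha beta la mu) (horner Y)) x =
      (\sum_(i < r.+1) Q i * Y^`(i)).[x] &
    forall Y : {poly R}, \det (seed_mx Y) != 0 ->
      \sum_(i < r.+1) Q i * Y^`(i) != 0].
Proof.
have [Q [sQ QE]] := seed_operator_t.
have shift (Y : {poly R}) : \sum_(i < r.+1) Q i * (Y \Po ('X - 1))^`(i) =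
    (\sum_(i < r.+1) (Q i \Po ('X + 1)) * Y^`(i)) \Po ('X - 1).
  rewrite rmorph_sum/=; apply: eq_bigr => i _.
  rewrite rmorphM/= -comp_polyA derivn_comp_XsubC; congr (_ * _).
  by rewrite comp_polyD comp_polyX comp_polyC subrK comp_polyXr.
exists (fun i => Q i \Po ('X + 1)); split=> [i|Y x x1|Y].
- by rewrite size_comp_poly2 ?size_XaddC.
- have z0 : 0 < 1 + x by lra.
  rewrite (@wronskian_euler _ r.+1 _ (@seed_exponent R beta la mu)
    (with_last (@seed_poly R alpha beta la mu) (Y \Po ('X - 1))))//; last 2 first.
  + by rewrite size_rcons size_cat !size_map !size_iota.
  + by move=> j y y1; apply: nth_seed_functions.
  rewrite -/(seed_mx Y) QE hornerM hornerXn mulrA mulrA -powRD; last first.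
    by rewrite (gt_eqF z0) implybT.
  rewrite -powR_mulrn 1?ltW// -powRD; last by rewrite (gt_eqF z0) implybT.
  (* All powers of 1 + x cancel: the prefactor, the Wronskian exponent -beta r2 - 'C(r + 1, 2), and
     d, by [bin2D] applied to (r1 + 1) + r2. *)
  rewrite sum_seed_exponent -/r2 (_ : _ + _ + _ = 0) ?powRr0 ?mul1r; last first.
    have -> : 'C(r.+1, 2)%:R = d%:R + (r1%:R + 1) * r2%:R :> R.
      by rewrite natr1 -natrM -natrD /r -addSn bin2D.
    by move: d%:R => e; ring.
  by rewrite shift horner_comp !hornerE/=; congr (_.[_]); ring.
by apply: contraNneq => Q0; rewrite QE shift Q0 comp_poly0 mulr0.
Qed.

Section Nondegenerate.
Hypothesis hmu : is_partition mu.
Hypothesis hn : forall i : nat, (i < r1)%N ->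
  alpha + beta + (assoc la i)%:R \notin negatives R (assoc la i).
Hypothesis hm : forall j : nat, (j < r2)%N ->
  alpha - beta + (assoc mu j)%:R \notin negatives R (assoc mu j).
Hypothesis hnm : forall i j : nat, (i < r1)%N -> (j < r2)%N ->
  beta != (assoc mu j)%:R - (assoc la i)%:R.

(** The top coefficient is the product of the leading coefficients and a determinant of falling
    factorials at the leading exponents n_i, m_j - beta and s. The hypotheses make these pairwise
    distinct. *)
Lemma det_seed_mx_neq0 (Y : {poly R}) s : size Y = s.+1 ->
    (forall i, (i < r1)%N -> s != assoc la i) ->
    (forall j : nat, (j < r2)%N -> beta != (assoc mu j)%:R - s%:R) ->
  \det (seed_mx Y) != 0.
Proof.
move=> sY sla smu.
pose D (c : 'I_r.+1) := if c == ord_max then s else @seed_degree la mu c.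
set p := with_last (@seed_poly R alpha beta la mu) (Y \Po ('X - 1)).
have sp c : size (p c) = (D c).+1.
  rewrite /p /with_last /D; case: eqP => [_|/eqP cr].
    by rewrite size_comp_poly2 ?size_XsubC.
  rewrite /seed_poly /seed_degree size_comp_poly2 ?size_XsubC//.
  case: ltnP => cr1; first exact/size_jacobi/hn.
  apply/size_jacobi/hm; rewrite ltn_subLR//.
  by move: cr; rewrite -val_eqE/= ltn_neqAle -ltnS ltn_ord andbT.
have := @coef_det_euler_mx_top _ _ (@seed_exponent R beta la mu) p D.
rewrite -/(seed_mx Y) => top.
have {}top : (\det (seed_mx Y))`_(\sum_c D c) != 0.
  rewrite top; last by move=> c; rewrite sp.
  rewrite mulf_neq0//.
    apply/prodf_neq0 => c _; rewrite -[D c]/((D c).+1.-1) -sp -lead_coefE.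
    by rewrite lead_coef_eq0 -size_poly_eq0 sp.
  pose val_at (c : 'I_r.+1) := seed_exponent (R := R) beta c + (D c)%:R.
  have low (c : 'I_r.+1) : (c < r1)%N -> val_at c = (assoc la c)%:R.
    move=> cr1; rewrite /val_at /D /seed_exponent /seed_degree leqNgt cr1/= add0r.
    by rewrite -val_eqE/= ltn_eqF// (leq_trans cr1)// leq_addr.
  have mid (c : 'I_r.+1) : (r1 <= c)%N -> (c < r)%N ->
      val_at c = - beta + (assoc mu (c - r1))%:R.
    move=> r1c cr; rewrite /val_at /D /seed_exponent /seed_degree r1c cr.
    rewrite ltnNge r1c/=.
    by rewrite -val_eqE/= ltn_eqF.
  have top' (c : 'I_r.+1) : ~~ (c < r)%N -> val_at c = s%:R.
    move=> cr; have -> : c = ord_max.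
      by apply/val_inj/eqP; rewrite /= eqn_leq -ltnS ltn_ord/= leqNgt.
    by rewrite /val_at /D eqxx seed_exponent_max add0r.
  (* Within a kind, distinctness comes from the strict decrease of [assoc], and from [sla] for s;
     across kinds, from [hnm] and [smu]. *)
  have sep (c c' : 'I_r.+1) : (c < c')%N -> val_at c != val_at c'.
    move=> cc'; have [cr1|r1c] := ltnP c r1.
      rewrite (low c)//; have [cr1'|r1c'] := ltnP c' r1.
        rewrite (low c')// eqr_nat.
        apply: contraTneq cc' => /(assoc_inj hla cr1 cr1') ->.
        by rewrite ltnn.
      have [cr'|cr'] := boolP (c' < r)%N; last by rewrite top'// eqr_nat eq_sym sla.
      rewrite mid// eq_sym addrC subr_eq addrC -subr_eq eq_sym hnm//.
      by rewrite ltn_subLR.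
    have [cr|cr] := boolP (c < r)%N; last first.
      by case/negP: cr; rewrite (leq_trans cc')// -ltnS.
    have cm : (c - r1 < r2)%N by rewrite ltn_subLR.
    rewrite mid//; have [cr'|cr'] := boolP (c' < r)%N.
      have r1c' : (r1 <= c')%N by exact: leq_trans r1c (ltnW cc').
      rewrite mid// (inj_eq (addrI _)) eqr_nat.
      have cm' : (c' - r1 < r2)%N by rewrite ltn_subLR.
      by apply/eqP => /(assoc_inj hmu cm cm'); lia.
    by rewrite top'// addrC subr_eq addrC -subr_eq eq_sym smu.
  apply: det_ffactr_neq0 => c c' E; apply/eqP; rewrite -val_eqE; apply/eqP.
  by case: (ltngtP c c') => // /sep; rewrite /val_at E eqxx.
by apply: contraNneq top => ->; rewrite coef0.
Qed.
End Nondegenerate.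
End ExceptionalJacobi.

(** * Orthogonality, degree and zeros of the exceptional polynomial *)

(** The bound on n makes the subtraction defining s exact; adding r1 to both sides of the excluded
    equalities turns them into s = n_i. *)
Lemma degree_seqE la mu n : is_partition la -> in_degree_seq la mu n ->
  (n + size la = shifted_degree la mu n + (sumn la + sumn mu))%N /\
  forall i, (i < size la)%N -> shifted_degree la mu n != assoc la i.
Proof.
move=> hla /andP[nge /forallP/= nne].
have nE : (n + size la = shifted_degree la mu n + (sumn la + sumn mu))%N.
  by rewrite /shifted_degree subnK//; lia.
split=> // i il; apply/eqP => sE; have /eqP := nne (Ordinal il) => /=; apply.
by move: nE; rewrite sE /assoc /=; lia.
Qed.

Lemma size_derivn_leq (R : numFieldType) (p : {poly R}) i :
  (size p^`(i) <= size p - i)%N.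
Proof.
by apply/leq_sizeP => j ij; rewrite coef_derivn nth_default ?mul0rn// -leq_subLR.
Qed.

Section Zeros.
Variables (R : realType) (alpha beta : R) (la mu : seq nat).
Hypothesis hla : is_partition la.
Let r1 := size la.
Let r2 := size mu.
Let r := (r1 + r2)%N.
Let C := (sumn la + sumn mu - r1)%N.

(** Term i involves P_(s-i) with parameters shifted by i, so the excess of the weight is r - i. As q
    Q_i has size at most s - 2 r + i, adding 2 (r - i) gives s - i, exactly what [jacobi_orthogonal]
    allows. *)
Lemma jacobi_operator_orthogonal (Q : nat -> {poly R}) s (q : {poly R}) :
    (forall i : 'I_r.+1, (size (Q i) <= (C + i).+1)%N) ->
    (size q <= s - (C + 2 * r))%N ->
  exists H, q * (\sum_(i < r.+1) Q i * (jacobi alpha beta s)^`(i)) =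
    jraise (alpha + r%:R) (beta + r%:R) H.
Proof.
move=> sQ sq.
have [q0|q0] := eqVneq q 0; first by exists 0; rewrite q0 mul0r jraise0.
(* A nonzero q makes the truncated difference s - (C + 2 r) positive, so i <= r <= s below. *)
have sq0 : (0 < size q)%N by rewrite lt0n size_poly_eq0.
have /choice[H HE] : forall i : 'I_r.+1, exists H,
    q * (Q i * (jacobi alpha beta s)^`(i)) =
      jraise (alpha + r%:R) (beta + r%:R) H.
  move=> i; have ir : (i <= r)%N by rewrite -ltnS.
  have [|k kE] := @jacobi_derivn _ alpha beta s i; first by lia.
  have [|H HE] := @jacobi_orthogonal _ (alpha + i%:R) (beta + i%:R) (r - i) (s - i)
      (k *: (q * Q i)).
    have := leq_trans (size_scale_leq k _) (size_polyMleq q (Q i)).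
    have := sQ i.
    by move: (size (Q i)) (size (k *: (q * Q i) : {poly R})%R) => x y; lia.
  exists H; rewrite kE mulrA -scalerAr scalerAl HE -!addrA -!natrD.
  by rewrite subnKC.
by exists (\sum_i H i); rewrite jraise_sum mulr_sumr; apply: eq_bigr => i _.
Qed.

Lemma exceptional_jacobi_zeros n :
    is_partition mu ->
    (forall i : nat, (i < r1)%N ->
       alpha + beta + (assoc la i)%:R \notin negatives R (assoc la i)) ->
    (forall j : nat, (j < r2)%N ->
       alpha - beta + (assoc mu j)%:R \notin negatives R (assoc mu j)) ->
    (forall i j : nat, (i < r1)%N -> (j < r2)%N ->
       beta != (assoc mu j)%:R - (assoc la i)%:R) ->
    -1 < alpha + r%:R -> -1 < beta + r%:R ->
    in_degree_seq la mu n ->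
    let s := shifted_degree la mu n in
    let p := exceptional_jacobi alpha beta la mu n in
    alpha + beta + s%:R \notin negatives R s ->
    (forall j : nat, (j < r2)%N -> beta != (assoc mu j)%:R - s%:R) ->
  [/\ n = (s + C)%N, (s - (C + 2 * r) <= nb_zeros p)%N &
      (3 * (s - (C + 2 * r)) <= 2 * nb_simple_zeros p + n)%N].
Proof.
move=> hmu hn hm hnm halpha hbeta hdeg s p hs hms.
have [nE sla] := degree_seqE hla hdeg.
have nsC : n = (s + C)%N.
  by have := size_partition_le hla; rewrite /C /s -/r1 in nE *; lia.
have [Q [sQ QE Q0]] := seed_operator alpha beta mu hla.
pose P := \sum_(i < r.+1) Q i * (jacobi alpha beta s)^`(i).
(* [P] witnesses that the choice made by [xget] is genuine; the two polynomials then agree at all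
   natural numbers. *)
have pE : p = P.
  have Ppoly : forall x, -1 < x ->
      P.[x] = exceptional_jacobi_fun alpha beta la mu n x.
    by move=> x x1; rewrite -QE.
  have pP : forall x, -1 < x -> p.[x] = exceptional_jacobi_fun alpha beta la mu n x.
    apply: (@xgetPex _ (0 : {poly R}) [set q : {poly R} | forall x, -1 < x ->
      q.[x] = exceptional_jacobi_fun alpha beta la mu n x]%classic).
    by exists P.
  apply: horner_infinite_eq => k; have k1 : -1 < k%:R :> R.
    by rewrite (lt_le_trans _ (ler0n _ _))// ltrN10.
  by rewrite pP// Ppoly.
have p0 : p != 0.
  rewrite pE; apply/Q0/(det_seed_mx_neq0 hla hmu hn hm hnm (s := s)) => //.
  exact: size_jacobi.
(* Q_i raises the degree by at most C + i and the i-th derivative lowers it by i. A vanishing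
   derivative is set apart because s + 1 - i may be truncated. *)
have sp : (size p <= n.+1)%N.
  rewrite pE /P; apply: leq_trans (size_sum _ _ _) _; apply/bigmax_leqP => i _.
  have [->|] := eqVneq ((jacobi alpha beta s)^`(i)) 0.
    by rewrite mulr0 size_poly0.
  rewrite -size_poly_gt0 => sJ0; rewrite nsC.
  have sQi : (size (Q i) <= (C + i).+1)%N := sQ i.
  have sJ : (size (jacobi alpha beta s)^`(i) <= s.+1 - i)%N.
    by rewrite -(size_jacobi hs) size_derivn_leq.
  apply: leq_trans (size_polyMleq _ _) _.
  move: sJ0 sQi sJ; move: (jacobi alpha beta s)^`(i) => Y; move: (nat_of_ord i) => k.
  by move: (size (Q k)) (size Y) => x y; lia.
have orth (q : {poly R}) : (size q <= s - (C + 2 * r))%N ->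
    exists H, q * p = jraise (alpha + r%:R) (beta + r%:R) H.
  by move=> sq; rewrite pE; apply: jacobi_operator_orthogonal.
by have [] := zeros_lower_bound halpha hbeta p0 sp orth.
Qed.
End Zeros.

(** * The bound on zeros and the growth of the simple zeros *)

Theorem theorem6p2 (R : realType) (la mu : seq nat) (alpha beta : R)
    (hla : is_partition la) (hmu : is_partition mu)
    (hn : forall i : nat, (i < size la)%N ->
       alpha + beta + (assoc la i)%:R \notin negatives R (assoc la i))
    (hm : forall j : nat, (j < size mu)%N ->
       alpha - beta + (assoc mu j)%:R \notin negatives R (assoc mu j))
    (hnm : forall i j : nat, (i < size la)%N -> (j < size mu)%N ->
       beta != (assoc mu j)%:R - (assoc la i)%:R)
    (halpha : -1 < alpha + (size la + size mu)%:R)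
    (hbeta : -1 < beta + (size la + size mu)%:R) :
  (forall n : nat, in_degree_seq la mu n ->
     let s := shifted_degree la mu n in
     let r := (size la + size mu)%N in
     alpha + beta + s%:R \notin negatives R (s + 2 * r) ->
     (forall j : nat, (j < size mu)%N -> beta != (assoc mu j)%:R - s%:R) ->
     n%:Z - 2 * ((sumn la)%:Z + (sumn mu)%:Z + (size mu)%:Z)
       <= (nb_zeros (exceptional_jacobi alpha beta la mu n))%:Z)
  /\
  (nb_simple_zeros (exceptional_jacobi alpha beta la mu n)
     @[n --> within [set n : nat | in_degree_seq la mu n] \oo] --> \oo).
Proof.
have szla := size_partition_le hla.
split=> [n hdeg s r hs hms|].
  have hs' : alpha + beta + s%:R \notin negatives R s.
    apply: contra hs => /mapP[j + ->]; rewrite mem_iota => /andP[j0 js].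
    apply/mapP; exists j => //; rewrite mem_iota j0/=; lia.
  have [nE Kn _] :=
    exceptional_jacobi_zeros hla hmu hn hm hnm halpha hbeta hdeg hs' hms.
  (* Here s - (C + 2 r) = n - 2 C - 2 r = n - 2 (|la| + |mu| + r2), before truncation. *)
  move: Kn nE; rewrite -/s; lia.
apply/cvgnyPge => A.
pose r := (size la + size mu)%N; pose C := (sumn la + sumn mu - size la)%N.
(* Once s > B, both alpha + beta + s > 0 and beta > m_j - s hold, so the conditions depending on s
   are automatic for large n. *)
pose B : R := `|alpha| + `|beta| + (\max_(j < size mu) assoc mu j)%:R.
pose M := Num.bound B.
have MB : B < M%:R by rewrite archi_boundP// !addr_ge0.
rewrite near_withinE; near=> n => /= hdeg.
have [nE _] := degree_seqE hla hdeg.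
set s := shifted_degree la mu n in nE.
(* With n = s + C, the bound 3 (s - C - 2 r) <= 2 N + n on the number N of simple zeros gives N >= s
   - 2 C - 3 r; the threshold makes this at least A, and M secures s > B. *)
have nbig : (M + A + 3 * C + 3 * r <= n)%N by near: n; exact: nbhs_infty_ge.
have sbig : (M + A + 2 * C + 3 * r <= s)%N by move: nE szla nbig; rewrite /C; lia.
have MsB : B < s%:R by rewrite (lt_le_trans MB)// ler_nat; lia.
have maxge : 0 <= (\max_(j < size mu) assoc mu j)%:R :> R by [].
have hs : alpha + beta + s%:R \notin negatives R s.
  apply/mapP => -[j _ E].
  have : 0 <= j%:R :> R by [].
  have := ler_norm (- alpha); have := ler_norm (- beta); rewrite !normrN.
  by move: MsB; rewrite /B; lra.
have hms j : (j < size mu)%N -> beta != (assoc mu j)%:R - s%:R.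
  move=> jm; apply/eqP => E.
  have : (assoc mu j)%:R <= (\max_(j < size mu) assoc mu j)%:R :> R.
    by rewrite ler_nat (leq_bigmax (Ordinal jm)).
  have := ler_norm (- beta); rewrite normrN; have := normr_ge0 alpha.
  by move: MsB; rewrite /B; lra.
have [sC _ Kn] :=
  exceptional_jacobi_zeros hla hmu hn hm hnm halpha hbeta hdeg hs hms.
move: Kn sC sbig; rewrite -/s -/r -/C; lia.
Unshelve. all: by end_near. Qed.
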